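(* For all integers $m\geq 3$ and $l$ with $\frac{m}{2}\leq l\leq m-1$, $$c_{m+1,\,2l-m-1}\leq\frac{A(m,l+1)}{A(m,l)}\leq d_{m+1,\,2l-m-1},$$ where $$c_{n,r}=\frac{(n-r)^2}{(n+r+2)^2}\cdot\frac{(4n-7r-8)(4n+3r+6)}{(4n+7r+6)(4n-3r)},\qquad d_{n,r}=\frac{n-r}{n+r+2}\cdot\frac{(n-r-2)(n-r+2)}{(n+r)(n+r+4)}.$$
   Context: For integers $m,l\geq 1$, the Eulerian number (of the first kind) $A(m,l)$ is the number of permutations of $\{1,\ldots,m\}$ in which exactly $l-1$ elements are greater than the previous element (i.e. permutations with exactly $l-1$ ascents). *)

(* Defs.v *)
From HB Require Import structures.
From mathcomp Require Import all_boot all_order all_algebra all_fingroup.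
Set Implicit Arguments.
Unset Strict Implicit.
Unset Printing Implicit Defensive.
Import Order.TTheory GRing.Theory Num.Theory.
Local Open Scope ring_scope.

(* A permutation s is read as the word s 0, s 1, ..., s (m - 1); an ascent is
   recorded by the position i of an entry that exceeds its predecessor. *)
Definition ascents (m : nat) (s : 'S_m) : {set 'I_m} :=
  [set i : 'I_m | [exists j : 'I_m, (j.+1 == i :> nat) && (s j < s i)%N]].

(* A(m, l) counts l - 1 ascents (so A(m, 1) = 1), not l; the successor on the
   left avoids truncated subtraction, and makes A(m, 0) = 0. *)
Definition eulerian (m l : nat) : nat :=
  #|[set s : 'S_m | #|ascents s|.+1 == l]|.

Definition c_bound (n r : rat) : rat :=
  (n - r) ^+ 2 / (n + r + 2) ^+ 2 *
  ((4 * n - 7 * r - 8) * (4 * n + 3 * r + 6) /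
   ((4 * n + 7 * r + 6) * (4 * n - 3 * r))).

Definition d_bound (n r : rat) : rat :=
  (n - r) / (n + r + 2) *
  ((n - r - 2) * (n - r + 2) / ((n + r) * (n + r + 4))).

(* Main.v *)
(* Inserting the largest letter gives A(m+1,l) = l A(m,l) + (m+2-l) A(m,l-1), so
   the ratio x(m,l) = A(m,l+1) / A(m,l) satisfies
     x(m+1,l) = ((l+1) x(m,l) + m+1-l) / (l + (m+2-l) / x(m,l-1)),
   which is increasing in both ratios on the right.  Both bounds then follow by
   induction on m, for m/2 <= l <= m, from rational function inequalities.  Two
   cases are treated apart: for m = 2l the recurrence would leave the range of
   the induction, but there the ratio is 1 by symmetry and so are both bounds;
   for l = m the ratio and the upper bound vanish and the lower one is <= 0. *)
Require Import Defs.
From HB Require Import structures.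
From mathcomp Require Import all_boot all_order all_algebra all_fingroup.
From mathcomp Require Import ring lra zify.
Set Implicit Arguments.
Unset Strict Implicit.
Unset Printing Implicit Defensive.
Import Order.TTheory GRing.Theory Num.Theory.
Local Open Scope ring_scope.

(** * The two bounds as functions of m and l *)

(** [ratio_lo] and [ratio_hi] are c and d at n = m + 1, r = 2 l - m - 1, where n - r = 2 (m + 1 - l)
    and n + r = 2 l. *)
Definition ratio_lo (F : fieldType) (m l : F) : F :=
  (m + 1 - l) ^+ 2 / (l + 1) ^+ 2 *
  ((11 * m - 14 * l + 3) * (m + 6 * l + 7) /
   ((14 * l - 3 * m + 3) * (7 * m - 6 * l + 7))).

Definition ratio_hi (F : fieldType) (m l : F) : F :=
  (m + 1 - l) * (m - l) * (m + 2 - l) / (l * (l + 1) * (l + 2)).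

Ltac nonzero_by_lra :=
  repeat match goal with |- is_true (_ && _) => apply/andP; split end;
  apply: lt0r_neq0; lra.

Lemma c_boundE (m l : rat) : 0 < l -> m <= 2 * l -> l <= m + 1 ->
  c_bound (m + 1) (2 * l - m - 1) = ratio_lo m l.
Proof.
by move=> l0 ml lm; rewrite /ratio_lo /c_bound; field; nonzero_by_lra.
Qed.

Lemma d_boundE (m l : rat) : 0 < l ->
  d_bound (m + 1) (2 * l - m - 1) = ratio_hi m l.
Proof. by move=> l0; rewrite /ratio_hi /d_bound; field; nonzero_by_lra. Qed.

(** * Inductive step: rational function inequalities *)

Section RatioStep.
Variable F : realFieldType.
Implicit Types a s l m o p q : F.

(** This is the recurrence with both ratios replaced by their bounds. In the coordinates a = m + 1 -
    l and s = 2 l - m - 2 the two sides differ by s (s + 1) (s + 2) / (l (l + 1) (l + 2)). *)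
Lemma ratio_hi_ineq a s l m : 0 < a -> 0 <= s ->
    l = a + s + 1 -> m = 2 * a + s ->
  (l + 1) * ratio_hi m l + a
    <= ratio_hi (m + 1) l * (l + (a + 1) / ratio_hi m (l - 1)).
Proof.
move=> a0 s0 -> ->; rewrite -subr_ge0.
rewrite [leRHS](_ : _ = s * (s + 1) * (s + 2) /
  ((a + s + 1) * (a + s + 2) * (a + s + 3))).
  by rewrite divr_ge0 // !mulr_ge0 //; lra.
by rewrite /ratio_hi; field; nonzero_by_lra.
Qed.

(** Here [o], [p], [q] stand for A(m,l-1), A(m,l), A(m,l+1), so the two combinations are A(m+1,l+1)
    and A(m+1,l). *)
Lemma ratio_hi_step m l o p q : m + 2 <= 2 * l -> l <= m ->
    0 < o -> 0 < p ->
    p <= ratio_hi m (l - 1) * o -> q <= ratio_hi m l * p ->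
  (l + 1) * q + (m + 1 - l) * p <=
    ratio_hi (m + 1) l * (l * p + (m + 2 - l) * o).
Proof.
move=> ml lm o0 p0 po qp.
have h1 : 0 < ratio_hi m (l - 1).
  by rewrite -(pmulr_lgt0 _ o0) (lt_le_trans p0).
have h2 : 0 <= ratio_hi (m + 1) l.
  by rewrite divr_ge0 // !mulr_ge0 //; lra.
have ineq : (l + 1) * ratio_hi m l + (m + 1 - l) <=
    ratio_hi (m + 1) l * (l + (m + 1 - l + 1) / ratio_hi m (l - 1)).
  by apply: (@ratio_hi_ineq _ (2 * l - m - 2)); lra.
have {}po : p / ratio_hi m (l - 1) <= o by rewrite ler_pdivrMr // mulrC.
apply: (@le_trans _ _ (((l + 1) * ratio_hi m l + (m + 1 - l)) * p)).
  by rewrite [leRHS]mulrDl lerD2r -mulrA ler_wpM2l //; lra.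
apply: le_trans (ler_wpM2r (ltW p0) ineq) _.
rewrite -mulrA ler_wpM2l // mulrDl lerD2l mulrAC -mulrA.
by rewrite (_ : m + 2 - l = m + 1 - l + 1) ?ler_wpM2l //; lra.
Qed.

(* In terms of a = m + 1 - l and s = 2 l - m - 2, the numerator of
   ratio_lo (m + 1) l has the sign of u = 8 a - 3 s; written in s and u, the
   difference of the two sides has nonnegative coefficients. *)
Lemma ratio_lo_ineq a s l m : 0 < a -> 0 <= s -> 0 < 8 * a - 3 * s ->
    l = a + s + 1 -> m = 2 * a + s ->
  ratio_lo (m + 1) l * (l + (a + 1) / ratio_lo m (l - 1))
    <= (l + 1) * ratio_lo m l + a.
Proof.
move=> a0 s0 u0 -> ->; rewrite -subr_ge0.
set u := 8 * a - 3 * s in u0 *.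
have u_ge0 : 0 <= u by rewrite ltW.
(* The coefficients below are written in base 1000 because numerals are unary,
   and d is opaque so that unification does not unfold them. *)
have [d dE] : exists d : nat -> nat -> nat -> F,
    forall x y z, d x y z = (x%:R * 1000 + y%:R) * 1000 + z%:R by eexists.
have d0 x y z : 0 <= d x y z.
  by rewrite dE; move: (ler0n F x) (ler0n F y) (ler0n F z); lra.
pose Q :=
  s * (d 1 919 232 + s * (d 12 570 768 + s * (d 34 24 914 +
    s * (d 47 789 973 + s * (d 36 210 888 +
    s * (d 13 954 248 + s * d 2 134 440)))))) +
  u * (d 0 319 872 + s * (d 3 386 768 + s * (d 12 578 154 +
    s * (d 22 440 496 + s * (d 20 680 298 +
    s * (d 9 436 854 + s * d 1 680 448))))) +
  u * (d 0 217 504 + s * (d 1 445 966 + s * (d 3 658 562 +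
    s * (d 4 368 682 + s * (d 2 453 513 + s * d 0 519 764)))) +
  u * (d 0 49 590 + s * (d 0 236 568 + s * (d 0 411 462 +
    s * (d 0 301 872 + s * d 0 78 324))) +
  u * (d 0 4 705 + s * (d 0 16 54 + s * (d 0 17 302 + s * d 0 5 740)) +
  u * (d 0 0 168 + s * (d 0 0 370 + s * d 0 0 164) + u))))).
have Q0 : 0 <= Q.
  by repeat first [exact: d0 | exact: s0 | exact: u_ge0
                  | apply: addr_ge0 | apply: mulr_ge0].
(* The denominator combines those of [ratio_lo (m + 1) l] and [ratio_lo m l] with the numerator
   factors of [ratio_lo m (l - 1)], except (a + 1)^2, which cancels. *)
rewrite [leRHS](_ : _ = 2 * (s + 1) * Q /
  ((8 * (a + s + 2)) ^+ 2 *
   ((8 * a + 11 * s + 14) * (8 * a + s + 8)) *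
   ((8 * a + 11 * s + 17) * (8 * a + s + 1)) *
   ((u + 3) * (8 * a + 7 * s + 7)))); last first.
  { rewrite /ratio_lo /Q !dE /u; field.
    by clear Q0 Q; rewrite /u in u0; nonzero_by_lra. }
clearbody Q; clear d dE d0.
by rewrite divr_ge0 // !(mulr_ge0, exprn_ge0) //; lra.
Qed.

(** Where [ratio_lo (m + 1) l] is not positive the claim is trivial. Otherwise u = 8 a - 3 s is
    positive, and so is [ratio_lo m (l - 1)], whose only factor of uncertain sign is u + 3; one may
    then divide by it. *)
Lemma ratio_lo_step m l o p q : m + 2 <= 2 * l -> l <= m ->
    0 < o -> 0 < p -> 0 <= q ->
    ratio_lo m (l - 1) * o <= p -> ratio_lo m l * p <= q ->
  ratio_lo (m + 1) l * (l * p + (m + 2 - l) * o) <=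
    (l + 1) * q + (m + 1 - l) * p.
Proof.
move=> ml lm o0 p0 q0 op pq.
have [h2|h2] := lerP (ratio_lo (m + 1) l) 0.
  apply: (@le_trans _ _ 0); last by rewrite addr_ge0 // mulr_ge0 //; lra.
  by rewrite mulr_le0_ge0 // addr_ge0 // mulr_ge0 //; lra.
have u0 : 0 < 8 * (m + 1 - l) - 3 * (2 * l - m - 2).
  rewrite ltNge; apply: contraTN h2 => u0; rewrite -leNgt.
  rewrite mulr_ge0_le0 //; first by rewrite divr_ge0 // exprn_ge0 //; lra.
  rewrite mulr_le0_ge0 //; last by rewrite invr_ge0 mulr_ge0 //; lra.
  by rewrite mulr_le0_ge0 //; lra.
have h1 : 0 < ratio_lo m (l - 1).
  by rewrite mulr_gt0 // divr_gt0 // ?exprn_gt0 ?mulr_gt0 //; lra.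
have ineq : ratio_lo (m + 1) l * (l + (m + 1 - l + 1) / ratio_lo m (l - 1)) <=
    (l + 1) * ratio_lo m l + (m + 1 - l).
  by apply: (@ratio_lo_ineq _ (2 * l - m - 2)); lra.
have {}op : o <= p / ratio_lo m (l - 1) by rewrite ler_pdivlMr // mulrC.
apply: (@le_trans _ _ (((l + 1) * ratio_lo m l + (m + 1 - l)) * p)); last first.
  by rewrite [leLHS]mulrDl lerD2r -mulrA ler_wpM2l //; lra.
apply: le_trans (ler_wpM2r (ltW p0) ineq).
rewrite -[leRHS]mulrA (ler_wpM2l (ltW h2)) // [leRHS]mulrDl lerD2l.
rewrite mulrAC -mulrA.
by rewrite (_ : m + 2 - l = m + 1 - l + 1) ?ler_wpM2l //; lra.
Qed.

End RatioStep.

(** * Recurrence by insertion of the largest letter *)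

Section EulerianRecurrence.
Local Open Scope nat_scope.

(** Positions are naturals under [inord], so that sums for words of different lengths can be
    compared. *)
Lemma card_ascents m (s : 'S_m.+1) :
  #|ascents s| = \sum_(i < m) (s (inord i) < s (inord i.+1)).
Proof.
rewrite -sum1_card big_mkcond big_ord_recl /= inE.
case: existsP => [[j]|_]; first by case/andP.
rewrite add0n; apply: eq_bigr => i _; rewrite inE.
have iE : lift ord0 i = inord i.+1 by apply: val_inj; rewrite /= inordK ?ltnS.
rewrite -iE; case: existsP => [[j /andP[/eqP ji lt]]|H].
  have {}ji : j = i :> nat by case: ji.
  by rewrite -ji inord_val lt.
case: (ltnP (s (inord i)) (s (lift ord0 i))) => // lti.
by case: H; exists (inord i); rewrite lti inordK ?eqxx // ltnW ?ltnS.
Qed.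

(** [lift_perm p ord_max s] is the word [s] with a new largest letter inserted at position [p]; old
    letters keep their values because [lift ord_max] does not change them. *)
Lemma lift_perm_lt m (s : 'S_m.+1) (p : 'I_m.+2) i : i < p ->
  lift_perm p ord_max s (inord i) = s (inord i) :> nat.
Proof.
move=> ip; have im : i < m.+1 by rewrite (leq_trans ip) // -ltnS.
have -> : inord i = lift p (inord i) :> 'I_m.+2.
  by apply: val_inj; rewrite /= /bump !inordK ?(leqW im) // leqNgt ip.
by rewrite lift_perm_lift lift_max.
Qed.

Lemma lift_perm_gt m (s : 'S_m.+1) (p : 'I_m.+2) i : p <= i -> i < m.+1 ->
  lift_perm p ord_max s (inord i.+1) = s (inord i) :> nat.
Proof.
move=> pi im; have -> : inord i.+1 = lift p (inord i) :> 'I_m.+2.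
  by apply: val_inj; rewrite /= /bump !inordK ?ltnS // pi.
by rewrite lift_perm_lift lift_max.
Qed.

(* Inserting the maximum at position p destroys the ascent ending at p, if there
   is one, and creates an ascent unless p = 0. *)
Lemma card_ascents_lift m (s : 'S_m.+1) (p : 'I_m.+2) :
  #|ascents (lift_perm p ord_max s)| +
    (0 < p <= m) && (s (inord p.-1) < s (inord p)) =
  #|ascents s| + (0 < p).
Proof.
set t := lift_perm _ _ _.
have tp : t p = ord_max by rewrite /t lift_perm_id.
rewrite !card_ascents.
rewrite -(big_mkord xpredT (fun i => t (inord i) < t (inord i.+1) : nat)).
rewrite -(big_mkord xpredT (fun i => s (inord i) < s (inord i.+1) : nat)).
(* Pairs before p ([low]) and after it ([high]) are those of [s]; the pair starting at p is a
   descent ([tpE]), the pair ending there an ascent ([lastt]). *)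
have low k : k < p -> \sum_(0 <= i < k) (t (inord i) < t (inord i.+1)) =
                      \sum_(0 <= i < k) (s (inord i) < s (inord i.+1)).
  move=> kp; apply: eq_big_nat => i /andP[_ ik].
  by rewrite !lift_perm_lt // ?(leq_ltn_trans _ kp) // ltnW.
have high : \sum_(p.+1 <= i < m.+1) (t (inord i) < t (inord i.+1)) =
            \sum_(p <= i < m) (s (inord i) < s (inord i.+1)).
  rewrite big_add1; apply: eq_big_nat => i /andP[pi im].
  by rewrite !lift_perm_gt // ltnW // ltnW.
have tpE : p < m.+1 -> (t (inord p) < t (inord p.+1)) = false.
  by move=> pm; rewrite inord_val tp; apply/negbTE; rewrite -leqNgt -ltnS.
have lastt k : p = k.+1 :> nat -> t (inord k) < t (inord k.+1).
  move=> pk; rewrite lift_perm_lt ?pk //; rewrite -pk inord_val tp /=.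
  by rewrite ltn_ord.
case: (posnP p) => [p0|p_gt0] /=.
  rewrite big_nat_recl //; have := tpE; rewrite p0 => -> //.
  rewrite add0n addn0.
  by move: high; rewrite p0 big_add1 /= => ->; rewrite addn0.
case Dp : (nat_of_ord p) p_gt0 => [//|k] _.
(* For k = m the letter is appended and no pair of [s] is broken. *)
have [km|mk] := ltnP k m; last first.
  have {mk} km : k = m.
    by apply/eqP; rewrite eqn_leq mk andbT -ltnS -ltnS -Dp ltn_ord.
  by subst k; rewrite addn0 big_nat_recr //= lastt // low ?Dp.
rewrite (@big_cat_nat _ _ _ k.+1 0 m.+1) /=; [|by []|by rewrite ltnS ltnW].
rewrite (@big_nat_recr _ _ _ k 0) //= lastt // low ?Dp //.
rewrite (@big_ltn _ _ _ k.+1 m.+1) ?ltnS // -Dp tpE ?Dp ?ltnS // add0n.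
rewrite -Dp high Dp.
rewrite (@big_cat_nat _ _ _ k.+1 0 m) //= big_nat_recr //=.
lia.
Qed.

(** Insertion at the front adds only a descent, and insertion inside an ascent trades it for a new
    one; every other place gains an ascent. *)
Lemma card_lift_same_ascents m (s : 'S_m.+1) :
  #|[set p : 'I_m.+2 | #|ascents (lift_perm p ord_max s)| == #|ascents s|]|
   = #|ascents s|.+1.
Proof.
rewrite (_ : [set p | _] = ord0 |: lift ord_max @: ascents s).
  rewrite cardsU1 card_imset; last exact: lift_inj.
  rewrite (_ : ord0 \notin _) ?add1n //.
  apply/imsetP => -[i]; rewrite inE => /existsP[j /andP[/eqP ji _]].
  by move/(congr1 val); rewrite /= /bump -ji addnS.
apply/setP => p; rewrite in_setU1 inE.
have := card_ascents_lift s p.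
case: (unliftP ord_max p) => [k|] ->; last first.
  rewrite /= ltnn /= addn0 addn1 => ->.
  rewrite eqn_leq ltnn; symmetry; apply/negbTE.
  by apply/imsetP => -[i _] /eqP; rewrite (negPf (neq_lift _ _)).
rewrite (mem_imset _ _ (@lift_inj _ _)) inE.
have kE : lift ord_max k = k :> nat by exact: lift_max.
have -> : (lift ord_max k == ord0) = (k == 0 :> nat) by rewrite -val_eqE -kE.
rewrite !kE -[k <= m]ltnS ltn_ord andbT.
case: (posnP k) => [->|k_gt0].
  by rewrite !addn0 => ->; rewrite eqxx.
rewrite inord_val /=.
have -> : [exists j : 'I_m.+1, (j.+1 == k) && (s j < s k)] =
          (s (inord k.-1) < s k).
  apply/existsP/idP => [[j /andP[/eqP <-]]|lt]; first by rewrite inord_val.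
  exists (inord k.-1); rewrite lt inordK ?prednK // ?eqxx //.
  by rewrite ltnW ?ltn_ord.
by case: (s _ < s k); lia.
Qed.

(** An insertion keeps the number of ascents or raises it by one, so the places that raise it are
    the complement of those already counted. *)
Lemma eulerian_card_lift m l (s : 'S_m.+1) :
  #|[set p : 'I_m.+2 | #|ascents (lift_perm p ord_max s)|.+1 == l.+1]| =
  (#|ascents s|.+1 == l.+1) * l.+1 + (#|ascents s|.+1 == l) * (m.+2 - l).
Proof.
have asc_le p :
    #|ascents s| <= #|ascents (lift_perm p ord_max s)| <= #|ascents s|.+1.
  have := card_ascents_lift s p.
  by case: posnP => _ /=; [lia | case: (_ && (s _ < _)); lia].
rewrite !eqSS; have [<-|nl] := eqVneq #|ascents s| l.
  rewrite mul1n (_ : _.+1 == _ = false) ?mul0n ?addn0; last by lia.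
  rewrite -[RHS]card_lift_same_ascents; apply: eq_card => p.
  by rewrite !inE eqSS.
rewrite mul0n add0n; have [<-|nl'] := eqVneq #|ascents s|.+1 l.
  have := cardsC [set p : 'I_m.+2 |
                    #|ascents (lift_perm p ord_max s)| == #|ascents s|].
  rewrite card_lift_same_ascents card_ord mul1n => /(canRL (addKn _)) <-.
  apply: eq_card => p; rewrite !inE eqSS; have := asc_le p.
  by lia.
rewrite mul0n; apply: eq_card0 => p; rewrite !inE eqSS; have := asc_le p.
by move: nl nl'; lia.
Qed.

Lemma lift_perm_max_inj m :
  injective (fun x : 'S_m * 'I_m.+1 => lift_perm x.2 ord_max x.1).
Proof.
move=> [s p] [s' p'] /= eq_lift; have pp' : p = p'.
  apply: (@perm_inj _ (lift_perm p ord_max s)).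
  by rewrite {2}eq_lift !lift_perm_id.
congr pair => //; apply/permP => i; apply: (@lift_inj _ ord_max).
by rewrite -!(lift_perm_lift p) eq_lift pp'.
Qed.

(** Insertion is injective, and (m + 1)! = (m + 1) m! makes it a bijection. *)
Lemma sum_lift_perm_max m (G : 'S_m.+1 -> nat) :
  \sum_(s : 'S_m.+1) G s =
  \sum_(s : 'S_m) \sum_(p : 'I_m.+1) G (lift_perm p ord_max s).
Proof.
rewrite pair_big /=.
rewrite (reindex (fun x : 'S_m * 'I_m.+1 => lift_perm x.2 ord_max x.1)) //=.
apply: onW_bij; apply: inj_card_bij; first exact: lift_perm_max_inj.
by rewrite card_prod !card_Sn card_ord factS mulnC.
Qed.

(** Truncation in [m.+2 - l] is harmless, as A(m+1,l) = 0 once l > m + 1. *)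
Lemma eulerianS m l :
  eulerian m.+2 l.+1 = l.+1 * eulerian m.+1 l.+1 + (m.+2 - l) * eulerian m.+1 l.
Proof.
have cardE n k : eulerian n k = \sum_(s : 'S_n) (#|ascents s|.+1 == k).
  rewrite /eulerian -sum1_card big_mkcond; apply: eq_bigr => s _.
  by rewrite inE; case: eqP.
rewrite [LHS]cardE sum_lift_perm_max !cardE !big_distrr /= -big_split /=.
apply: eq_bigr => s _; rewrite mulnC [X in _ + X]mulnC -eulerian_card_lift.
rewrite -sum1_card [RHS]big_mkcond; apply: eq_bigr => p _.
by rewrite inE; case: eqP.
Qed.

End EulerianRecurrence.

(** * Boundary values, symmetry and positivity of Eulerian numbers *)

Lemma eulerian0 m : eulerian m 0 = 0%N.
Proof. by apply: eq_card0 => s; rewrite inE. Qed.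

Lemma eulerian1 l : eulerian 1 l = (l == 1%N).
Proof.
rewrite /eulerian (_ : [set s | _] = if l == 1%N then setT else set0).
  by case: ifP => _; rewrite ?cards0 // cardsT card_Sn.
apply/setP => s; rewrite inE card_ascents big_ord0 eq_sym.
by case: ifP; rewrite !inE.
Qed.

Lemma eulerian_gt m l : (m.+1 < l)%N -> eulerian m.+1 l = 0%N.
Proof.
elim: m l => [|m IH] [|l] // lm; first by rewrite eulerian1 gtn_eqF.
by rewrite eulerianS !IH ?muln0 // ltnW.
Qed.

(** When l + k = m + 1, the recurrences for A(m+2,l+1) and A(m+2,k+1) have the same two terms in
    opposite order, since m + 2 - l = k + 1. *)
Lemma eulerian_sym m l k : (l + k = m.+2)%N ->
  eulerian m.+1 l = eulerian m.+1 k.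
Proof.
elim: m l k => [|m IH] l k lk.
  by rewrite !eulerian1; congr (nat_of_bool _); apply/eqP/eqP; lia.
case: l k lk => [|l] [|k] // lk; [by rewrite eulerian0 eulerian_gt //; lia..|].
by rewrite !eulerianS (IH l.+1 k) ?(IH l k.+1); lia.
Qed.

Lemma eulerian_gt0 m l : (0 < l <= m.+1)%N -> (0 < eulerian m.+1 l)%N.
Proof.
elim: m l => [|m IH] [|l] // lm; first by rewrite eulerian1; lia.
rewrite eulerianS addn_gt0 !muln_gt0 /=.
have [->|l0] := posnP l; first by rewrite IH.
by rewrite (IH l) ?orbT ?andbT; lia.
Qed.

(** * Ends of the range and the induction on m *)

Lemma ratio_lo_mid (F : realFieldType) (l : F) : 0 < l ->
  ratio_lo (2 * l) l = 1.
Proof. by move=> l0; rewrite /ratio_lo; field; nonzero_by_lra. Qed.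

Lemma ratio_hi_mid (F : realFieldType) (l : F) : 0 < l ->
  ratio_hi (2 * l) l = 1.
Proof. by move=> l0; rewrite /ratio_hi; field; nonzero_by_lra. Qed.

(** On the diagonal the factor 11 m - 14 l + 3 becomes 3 (1 - m). *)
Lemma ratio_lo_diag (F : realFieldType) (m : F) : 1 <= m -> ratio_lo m m <= 0.
Proof.
move=> m1; rewrite mulr_ge0_le0 //.
  by rewrite divr_ge0 // exprn_ge0 //; lra.
rewrite mulr_le0_ge0 //; last by rewrite invr_ge0 mulr_ge0 //; lra.
by rewrite mulr_le0_ge0 //; lra.
Qed.

Lemma ratio_hi_diag (F : fieldType) (m : F) : ratio_hi m m = 0.
Proof. by rewrite /ratio_hi subrr mulr0 !mul0r. Qed.

(** The range includes the diagonal because the step from m to m + 1 at l = m calls on it. *)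
Lemma eulerian_ratio (F : realFieldType) (m l : nat) :
    (m.+1 <= 2 * l)%N -> (l <= m.+1)%N ->
  ratio_lo m.+1%:R l%:R * (eulerian m.+1 l)%:R <= (eulerian m.+1 l.+1)%:R :> F
  /\
  (eulerian m.+1 l.+1)%:R <= ratio_hi m.+1%:R l%:R * (eulerian m.+1 l)%:R :> F.
Proof.
have top n : ratio_lo n.+1%:R n.+1%:R * (eulerian n.+1 n.+1)%:R <=
      (eulerian n.+1 n.+2)%:R :> F /\
    (eulerian n.+1 n.+2)%:R <=
      ratio_hi n.+1%:R n.+1%:R * (eulerian n.+1 n.+1)%:R :> F.
  rewrite (@eulerian_gt n n.+2) // ratio_hi_diag mul0r; split=> //.
  by rewrite mulr_le0_ge0 ?ratio_lo_diag // ler1n.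
elim: m l => [|m IH] l ml lm.
  by rewrite (_ : l = 1%N); [exact: top | lia].
have [->|lm1] := eqVneq l m.+2; first exact: top.
have [m2l|ml3] := eqVneq m.+2 (2 * l)%N.
  have l0 : 0 < l%:R :> F by rewrite ltr0n; lia.
  rewrite (@eulerian_sym _ l.+1 l); last by lia.
  by rewrite m2l natrM ratio_lo_mid // ratio_hi_mid // !mul1r.
(* Now both l and l - 1 lie in the range of the induction hypothesis. *)
have {ml ml3 lm lm1} [ml3 lm] : (m.+3 <= 2 * l)%N /\ (l <= m.+1)%N by lia.
case: l => [|k] in ml3 lm *; first by lia.
have [lo1 hi1] := IH k.+1 ltac:(lia) ltac:(lia).
have [lo0 hi0] := IH k ltac:(lia) ltac:(lia).
have o0 : 0 < (eulerian m.+1 k)%:R :> F by rewrite ltr0n eulerian_gt0 //; lia.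
have p0 : 0 < (eulerian m.+1 k.+1)%:R :> F.
  by rewrite ltr0n eulerian_gt0 //; lia.
have kE : k%:R = k.+1%:R - 1 :> F by rewrite -natr1 addrK.
have mE : m.+2%:R = m.+1%:R + 1 :> F by rewrite natr1.
have ml3F : m.+1%:R + 2 <= 2 * k.+1%:R :> F.
  by rewrite -natrD -natrM ler_nat; lia.
have lmF : k.+1%:R <= m.+1%:R :> F by rewrite ler_nat.
rewrite kE in lo0 hi0.
have lo2 := ratio_lo_step ml3F lmF o0 p0 (ler0n _ _) lo0 lo1.
have hi2 := ratio_hi_step ml3F lmF o0 p0 hi0 hi1.
have -> : (eulerian m.+2 k.+2)%:R = (k.+1%:R + 1) * (eulerian m.+1 k.+2)%:R +
    (m.+1%:R + 1 - k.+1%:R) * (eulerian m.+1 k.+1)%:R :> F.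
  by rewrite eulerianS natrD !natrM natrB ?mE; [ring | lia].
have -> : (eulerian m.+2 k.+1)%:R = k.+1%:R * (eulerian m.+1 k.+1)%:R +
    (m.+1%:R + 2 - k.+1%:R) * (eulerian m.+1 k)%:R :> F.
  by rewrite eulerianS natrD !natrM natrB ?mE; [ring | lia].
by rewrite mE.
Qed.

(** * Return to quotients and to the variables n and r *)

Theorem corollary4p1 (m l : nat) (hm : (3 <= m)%N)
    (hml : (m%:R / 2 <= l%:R :> rat)) (hlm : (l <= m - 1)%N) :
  c_bound (m%:R + 1) (2 * l%:R - m%:R - 1)
    <= (eulerian m l.+1)%:R / (eulerian m l)%:R
  /\ (eulerian m l.+1)%:R / (eulerian m l)%:R
    <= d_bound (m%:R + 1) (2 * l%:R - m%:R - 1).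
Proof.
have m2l : (m <= 2 * l)%N.
  by move: hml; rewrite ler_pdivrMr // -natrM ler_nat mulnC.
have l0 : 0 < l%:R :> rat by rewrite ltr0n; lia.
rewrite d_boundE // c_boundE //; last 2 first.
- by rewrite -natrM ler_nat.
- by rewrite natr1 ler_nat; lia.
case: m => [//|m] in hm hml hlm m2l *.
have e0 : 0 < (eulerian m.+1 l)%:R :> rat by rewrite ltr0n eulerian_gt0 //; lia.
rewrite ler_pdivlMr // ler_pdivrMr //.
by apply: eulerian_ratio => //; lia.
Qed.
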